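(* Suppose that for every Hilbert space $H$, every completely hyperreflexive von Neumann algebra $\mathcal{A}\subseteq B(H)$ and every projection $Q\in B(H)$, the algebra $\mathcal{A}\cap\{Q\}'$ is completely hyperreflexive. Then for every Hilbert space $H$, every $n\in\mathbb{N}$ and all projections $Q_1,\dots,Q_n\in B(H)$, the algebra $\{Q_1\}'\cap\dots\cap\{Q_n\}'$ is hyperreflexive.
   Context: $B(H)$ is the space of bounded linear operators on a Hilbert space $H$, and $'$ denotes the commutant in $B(H)$. For an operator space $\mathcal{X}\subseteq B(H)$ and $T\in B(H)$, put $r_{\mathcal{X}}(T)=\sup\{|\langle T\xi,\eta\rangle| : \|\xi\|=\|\eta\|=1,\ \langle X\xi,\eta\rangle=0\ \forall X\in\mathcal{X}\}$ and $d(T,\mathcal{X})=\inf_{X\in\mathcal{X}}\|T-X\|$. A reflexive space $\mathcal{X}\subseteq B(H)$ (i.e. one for which $T\in\mathcal{X}$ whenever $T\xi\in\overline{\mathcal{X}\xi}$ for all $\xi\in H$; von Neumann algebras are reflexive) is hyperreflexive if there is $k>0$ with $d(T,\mathcal{X})\le k\,r_{\mathcal{X}}(T)$ for all $T\in B(H)$. For a set $I$, $M_I(\mathcal{X})$ is the space of $I\times I$ matrices with entries in $\mathcal{X}$ whose finite submatrices have uniformly bounded norm, acting on $H\otimes\ell^2(I)$ (identified with $\mathcal{X}\bar\otimes B(\ell^2(I))$). A reflexive space $\mathcal{X}$ is completely hyperreflexive if $M_I(\mathcal{X})$ is hyperreflexive for every set $I$. *)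

(* Defs.v *)
From HB Require Import structures.
From mathcomp Require Import all_boot all_order all_algebra.
From mathcomp Require Import finmap complex.
From mathcomp Require Import all_classical all_reals all_analysis.
From mathcomp Require Import summability.
From mathcomp Require Import ring lra.

Set Implicit Arguments.
Unset Strict Implicit.
Unset Printing Implicit Defensive.

Import Order.TTheory GRing.Theory Num.Theory.
Import numFieldNormedType.Exports.

Local Open Scope classical_set_scope.
Local Open Scope ring_scope.
Local Open Scope complex_scope.

#[export] Existing Instance totally_filter.

(* The inner product is linear in its first argument. *)
HB.mixin Record CompleteNormedModule_isHilbert (R : realType) H
    & CompleteNormedModule R[i] H := {
  hdot : {dot H for @Num.conj R[i]} ;
  hdot_norm : forall x : H, `|x| ^+ 2 = hdot x x
}.

#[short(type="hilbertType")]
HB.structure Definition Hilbert (R : realType) :=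
  {H of CompleteNormedModule R[i] H & CompleteNormedModule_isHilbert R H}.

Section BoundedOperators.
Context {R : realType} (H : hilbertType R).

(* For linear maps, continuity is boundedness: linear_bounded_continuous. *)
Definition bounded_operator : {pred (H -> H)} :=
  fun T => `[< linear T /\ continuous T >].

Lemma bounded_operator_submod_closed : submod_closed bounded_operator.
Proof.
split.
  apply/asboolP; split; last by move=> x; exact: cvg_cst.
  by move=> a x y /=; rewrite scaler0 addr0.
move=> a S T /asboolP[lS cS] /asboolP[lT cT]; apply/asboolP; split.
  move=> b x y; rewrite -[LHS]/(a *: S _ + T _) lS lT.
  rewrite -[RHS]/(b *: (a *: S x + T x) + (a *: S y + T y)).
  by rewrite !scalerDr !scalerA addrACA mulrC.
by move=> x; apply: cvgD; [apply: cvgZl_tmp; exact: cS|exact: cT].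
Qed.

HB.instance Definition _ := GRing.isSubmodClosed.Build R[i] (H -> H)
  bounded_operator bounded_operator_submod_closed.

Record bop := Bop { bop_fun :> H -> H; bop_in : bounded_operator bop_fun }.

HB.instance Definition _ := [isSub for bop_fun].
HB.instance Definition _ := [Choice of bop by <:].
HB.instance Definition _ := [SubChoice_isSubLmodule of bop by <:].

End BoundedOperators.

Section DotProduct.
Context {C : numClosedFieldType} (U : lmodType C) (form : {dot U for @Num.conj C}).

Lemma dot_CauchySchwarz (u v : U) : `|form u v| ^+ 2 <= form u u * form v v.
Proof.
have [->|nz_v] := eqVneq v 0; first by rewrite (linear0r form u) (linear0r form 0) normr0 mulr0 expr0n.
pose a := form u v / form v v; pose w := u - a *: v.
have ow : form w v = 0.
  by rewrite /w linearBl/= linearZl_LR/= divfK ?dnorm_eq0 ?subrr.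
have -> : u = w + a *: v by rewrite /w subrK.
rewrite linearDl/= ow add0r linearZl_LR/= normrM (ger0_norm (dnorm_ge0 _ _)).
rewrite exprMn hnormDd/=; last by rewrite linearZr_LR/= ow mulr0.
rewrite dnormZ mulrDl [form v v ^+ 2]expr2 mulrA lerDr.
by rewrite mulr_ge0 ?dnorm_ge0.
Qed.

Lemma dot_triangle (u v : U) :
  sqrtC (form (u + v) (u + v)) <= sqrtC (form u u) + sqrtC (form v v).
Proof.
rewrite -ler_sqr ?nnegrE ?addr_ge0 ?sqrt_dnorm_ge0//.
rewrite sqrrD !sqrtCK addrAC dnormD lerD2l/=.
have -> : form u v + Num.conj (form u v) = 'Re (form u v) *+ 2.
  by rewrite ReE mulr2n -splitr.
rewrite lerMn2r/=.
have le1 := (leif_Re_Creal (form u v)).1.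
apply: (le_trans le1).
rewrite -ler_sqr ?nnegrE ?mulr_ge0 ?sqrt_dnorm_ge0 ?normr_ge0//.
by rewrite exprMn !sqrtCK dot_CauchySchwarz.
Qed.

End DotProduct.

Section RealNorm.
Context {R : realType}.

(* Norms over R[i] take their values in R[i]; rnorm is the same number in R. *)
Definition rnorm (V : normedZmodType R[i]) (x : V) : R := complex.Re `|x|.

Lemma rnormE (V : normedZmodType R[i]) (x : V) : (rnorm x)%:C = `|x|.
Proof. exact: RRe_real (normr_real x). Qed.

Lemma rnorm_ge0 (V : normedZmodType R[i]) (x : V) : 0 <= rnorm x.
Proof. rewrite -lecR rnormE; exact: normr_ge0. Qed.

Lemma ler_rnormB (V : normedZmodType R[i]) (x y : V) :
  `|rnorm x - rnorm y| <= rnorm (x - y).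
Proof.
have le (u v : V) : rnorm u - rnorm v <= rnorm (u - v).
  rewrite lerBlDr -lecR rmorphD/= !rnormE -{1}(subrK v u).
  exact: ler_normD.
by rewrite ler_norml lerNl opprB !le andbT -lecR rnormE distrC -rnormE lecR le.
Qed.

End RealNorm.

Section FiniteSums.
Context {R : realType} {I : choiceType}.
Implicit Types (F G : {fset I}) (u v : I -> R) (M : R).

Lemma partial_sumE (V : zmodType) (x : I -> V) F :
  partial_sum x F = \sum_(i <- F) x i.
Proof. by rewrite /partial_sum big_seq_fsetE. Qed.

Lemma le_fsum u F G : (forall i, 0 <= u i) -> (F `<=` G)%fset ->
  \sum_(i <- F) u i <= \sum_(i <- G) u i.
Proof.
move=> u0 FG; rewrite (big_fsetID _ (fun i => i \in F) G)/=.
have -> : [fset x in G | x \in F]%fset = F.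
  apply/fsetP => i; rewrite !inE/= andbC; case: (boolP (i \in F)) => //=.
  exact: (fsubsetP FG).
by rewrite lerDl sumr_ge0.
Qed.

Lemma nneg_sum_cvg u M : (forall i, 0 <= u i) ->
  (forall F, \sum_(i <- F) u i <= M) ->
  partial_sum u @ totally --> sup [set \sum_(i <- F) u i | F in [set: {fset I}]].
Proof.
move=> u0 uM; set A := [set _ | _ in _].
have supA : has_sup A.
  split; first by exists (\sum_(i <- fset0) u i), fset0.
  by exists M => _ [F _ <-]; exact: uM.
apply/cvgrPdist_lt => e e0.
have [_ [F _ <-] Fe] := sup_adherent e0 supA.
exists F => // G /= FG; rewrite partial_sumE.
have GA : \sum_(i <- G) u i <= sup A.
  by apply: ub_le_sup; [exact: supA.2|exists G].
rewrite ger0_norm ?subr_ge0// ltrBlDr -ltrBlDl.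
exact: lt_le_trans Fe (le_fsum u0 FG).
Qed.

Lemma real_sum_cvg v M : (forall F, \sum_(i <- F) `|v i| <= M) ->
  exists l : R, partial_sum v @ totally --> l.
Proof.
move=> vM; have abs_cvg := nneg_sum_cvg (fun i => normr_ge0 (v i)) vM.
have vv0 i : 0 <= `|v i| - v i by rewrite subr_ge0 ler_norm.
have vvM F : \sum_(i <- F) (`|v i| - v i) <= M + M.
  rewrite sumrB lerD// (le_trans _ (vM F))// (le_trans (ler_norm _))//.
  by rewrite normrN ler_norm_sum.
eexists; apply: cvg_trans; last exact: cvgB abs_cvg (nneg_sum_cvg vv0 vvM).
apply: near_eq_cvg; apply: nearW => F /=.
transitivity (partial_sum (fun i => `|v i|) F -
  partial_sum (fun i => `|v i| - v i) F) => //.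
rewrite !partial_sumE -sumrB.
by apply: eq_bigr => i _; rewrite subKr.
Qed.

Lemma cvg_real_complex T (F : set_system T) (FF : Filter F) (f : T -> R) (l : R) :
  f @ F --> l -> ((f x)%:C : R[i]^o) @[x --> F] --> (l%:C : R[i]^o).
Proof.
move=> /cvgrPdist_lt fl; apply/cvgrPdist_lt => e e0.
have := e0; rewrite -(RRe_real (gtr0_real e0)) ltcR => Re0.
near=> x; rewrite -rmorphB/= -rnormE ltcR.
rewrite /rnorm normc_def/= expr0n addr0 sqrtr_sqr.
by near: x; exact: fl.
Unshelve. all: by end_near. Qed.

Lemma sum_real_complex (s : seq I) u :
  \sum_(i <- s) (u i)%:C = (\sum_(i <- s) u i)%:C.
Proof. by rewrite (big_morph _ (rmorphD _) (rmorph0 _)). Qed.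

Lemma complex_sum_cvg (w : I -> R[i]) M :
  (forall F, \sum_(i <- F) rnorm (w i) <= M) ->
  cvg (partial_sum (w : I -> R[i]^o) @ totally).
Proof.
move=> wM.
have ReM F : \sum_(i <- F) `|complex.Re (w i)| <= M.
  apply: le_trans (wM F); apply: ler_sum => i _.
  by rewrite -lecR rnormE normc_ge_Re.
have ImM F : \sum_(i <- F) `|complex.Im (w i)| <= M.
  apply: le_trans (wM F); apply: ler_sum => i _.
  rewrite -lecR rnormE -normrN -ReiNIm (le_trans (normc_ge_Re _))//.
  by rewrite normrM [X in _ * X]normc_def/= expr0n expr1n add0r sqrtr1 mulr1.
have [a /cvg_real_complex ca] := real_sum_cvg ReM.
have [b /cvg_real_complex cb] := real_sum_cvg ImM.
have cib := cvgZl_tmp (k := 'i%C) cb.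
have cab := cvgD ca (cib _).
apply/cvg_ex; eexists; apply: cvg_trans; last exact: cab.
apply: near_eq_cvg; apply: nearW => F /=.
transitivity ((partial_sum (fun i => complex.Re (w i)) F)%:C +
  'i%C * (partial_sum (fun i => complex.Im (w i)) F)%:C) => //.
rewrite !partial_sumE.
rewrite -!sum_real_complex mulr_sumr -big_split/=.
by apply: eq_bigr => i _; rewrite -complexE.
Qed.

End FiniteSums.

Section HilbertNorm.
Context {R : realType} (H : hilbertType R).
Implicit Types (x y : H) (a : R[i]).

Lemma ler_rnormD x y : rnorm (x + y) <= rnorm x + rnorm y.
Proof. by rewrite -lecR rmorphD/= !rnormE ler_normD. Qed.

Lemma rnormZ a x : rnorm (a *: x) = rnorm a * rnorm x.
Proof. by apply: complexI; rewrite rmorphM/= !rnormE normrZ. Qed.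

Lemma rnorm_sqr x : (rnorm x ^+ 2)%:C = hdot x x.
Proof. by rewrite rmorphXn/= rnormE hdot_norm. Qed.

Lemma rnorm_hdot_le x y : rnorm (hdot x y) <= rnorm x * rnorm y.
Proof.
rewrite -ler_sqr ?nnegrE ?mulr_ge0 ?rnorm_ge0// -lecR !rmorphXn/= rmorphM/=.
by rewrite !rnormE exprMn !hdot_norm dot_CauchySchwarz.
Qed.

End HilbertNorm.

(* ell2 I H, the square-summable families in H, is the Hilbert space tensor
   product of H and l^2(I): x \otimes e_i is the family with x at index i and
   0 elsewhere. *)
Section Ell2.
Context {R : realType} (I : choiceType) (H : hilbertType R).

Definition square_summable : {pred (I -> H)} :=
  fun f => `[< summability.summable (fun i => rnorm (f i) ^+ 2 : R^o) >].

Lemma square_summableP f :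
  reflect (exists M : R, forall F : {fset I}, \sum_(i <- F) rnorm (f i) ^+ 2 <= M)
    (f \in square_summable).
Proof.
have sqr0 i : 0 <= rnorm (f i) ^+ 2 by exact: sqr_ge0.
have normE (F : {fset I}) :
    partial_sum (fun i => `|rnorm (f i) ^+ 2 : R^o|) F =
    \sum_(i <- F) rnorm (f i) ^+ 2.
  by rewrite partial_sumE; apply: eq_bigr => i _; rewrite ger0_norm.
apply: (iffP (asboolP _)) => [[M0 [_ sM]]|[M fM]].
  have M1 : M0 < M0 + 1 by rewrite ltrDl.
  have [J _ JM] := sM _ M1; exists (M0 + 1) => F.
  have := JM (F `|` J)%fset (fsubsetUr _ _); rewrite /= normE.
  by apply: le_trans; apply: le_fsum => //; exact: fsubsetUl.
exists M; split=> [|M' MM']; first exact: num_real.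
by apply: nearW => F; rewrite normE (le_trans (fM F))// ltW.
Qed.

Lemma square_summable_submod_closed : submod_closed square_summable.
Proof.
split.
  apply/square_summableP; exists 0 => F; rewrite big1// => i _.
  by rewrite /rnorm normr0/= expr0n.
move=> a f g /square_summableP[M fM] /square_summableP[N gN].
apply/square_summableP; exists (rnorm a ^+ 2 * M *+ 2 + N *+ 2) => F.
apply: (@le_trans _ _ (\sum_(i <- F) (rnorm a ^+ 2 * rnorm (f i) ^+ 2 *+ 2 +
                                     rnorm (g i) ^+ 2 *+ 2))).
  apply: ler_sum => i _.
  have := ler_rnormD (a *: f i) (g i); rewrite rnormZ.
  have := rnorm_ge0 (a *: f i + g i); have := rnorm_ge0 (g i).
  have : 0 <= rnorm a * rnorm (f i) by rewrite mulr_ge0 ?rnorm_ge0.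
  rewrite -exprMn -[(a *: f + g) i]/(a *: f i + g i).
  move: (rnorm a * _) (rnorm (g i)) (rnorm (_ + _)) => s t u s0 t0 u0 ust.
  apply: (@le_trans _ _ ((s + t) ^+ 2)).
    by rewrite ler_sqr ?nnegrE ?addr_ge0.
  rewrite -subr_ge0 (_ : _ - _ = (s - t) ^+ 2) ?sqr_ge0//; ring.
rewrite big_split/= !sumrMnl -mulr_sumr lerD// lerMn2r/=//.
by rewrite ler_wpM2l// sqr_ge0.
Qed.

HB.instance Definition _ := GRing.isSubmodClosed.Build R[i] (I -> H)
  square_summable square_summable_submod_closed.

Record ell2 := Ell2 { ell2_fun :> I -> H; ell2_in : square_summable ell2_fun }.

HB.instance Definition _ := [isSub for ell2_fun].
HB.instance Definition _ := [Choice of ell2 by <:].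
HB.instance Definition _ := [SubChoice_isSubLmodule of ell2 by <:].

Implicit Types f g h : ell2.

Lemma ell2DE f g i : (f + g) i = f i + g i. Proof. by []. Qed.
Lemma ell2ZE a f i : (a *: f) i = a *: f i. Proof. by []. Qed.
Lemma ell2BE f g i : (f - g) i = f i - g i. Proof. by []. Qed.

Lemma ell2P f : exists M : R, forall F : {fset I}, \sum_(i <- F) rnorm (f i) ^+ 2 <= M.
Proof. by apply/square_summableP; exact: ell2_in. Qed.

Definition ell2_dot f g : R[i] :=
  summability.sum (fun i => hdot (f i) (g i) : R[i]^o).

Lemma ell2_dot_cvg f g :
  partial_sum (fun i => hdot (f i) (g i) : R[i]^o) @ totally --> (ell2_dot f g : R[i]^o).
Proof.
have [M fM] := ell2P f; have [N gN] := ell2P g.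
apply: (@complex_sum_cvg _ _ _ (M + N)) => F.
rewrite (le_trans _ (lerD (fM F) (gN F)))// -big_split/=; apply: ler_sum => i _.
apply: le_trans (rnorm_hdot_le _ _) _.
have := rnorm_ge0 (f i); have := rnorm_ge0 (g i).
move: (rnorm (f i)) (rnorm (g i)) => s t t0 s0.
have := sqr_ge0 (s - t); have := mulr_ge0 s0 t0; rewrite sqrrB; lra.
Qed.

Lemma ell2_dot_linearl h : linear_for *%R (ell2_dot^~ h).
Proof.
move=> a f g; apply: (@cvg_lim R[i]^o) => //.
have cf := cvgZl_tmp (k := a) (@ell2_dot_cvg f h).
have cg := cvgD (cf _) (@ell2_dot_cvg g h).
apply: cvg_trans; last exact: cg.
apply: near_eq_cvg; apply: nearW => F /=.
transitivity (a * partial_sum (fun i => hdot (f i) (h i)) F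
   + partial_sum (fun i => hdot (g i) (h i)) F) => //.
rewrite !partial_sumE mulr_sumr -big_split/=; apply: eq_bigr => i _.
by have := linearDl hdot (h i) (a *: f i) (g i); rewrite linearZl_LR => <-.
Qed.

Lemma ell2_dot_hermitian f g : ell2_dot f g = (-1) ^+ false * Num.conj (ell2_dot g f).
Proof.
rewrite expr0 mul1r; apply: (@cvg_lim R[i]^o) => //.
apply/cvgrPdist_lt => e e0.
have /cvgrPdist_lt/(_ e e0) := @ell2_dot_cvg g f.
apply: filterS => F; rewrite -[X in X < e -> _]norm_conjC rmorphB.
rewrite !partial_sumE rmorph_sum/=.
by under eq_bigr do rewrite -[Num.conj _]mul1r -[1](expr0 (-1)) -[0%N]/(false : nat) -hermC.
Qed.

Lemma ell2_dot_linearr f : linear_for (@Num.conj R[i] \; *%R) (ell2_dot f).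
Proof.
move=> a g h; rewrite !(ell2_dot_hermitian f) !expr0 !mul1r.
by rewrite ell2_dot_linearl rmorphD rmorphM.
Qed.

Lemma ell2_dotE f : ell2_dot f f =
  (sup [set \sum_(i <- F) rnorm (f i) ^+ 2 | F in [set: {fset I}]])%:C.
Proof.
have [M fM] := ell2P f; apply: (@cvg_lim R[i]^o) => //.
have c := nneg_sum_cvg (fun i => sqr_ge0 (rnorm (f i))) fM.
apply: cvg_trans; last exact: (cvg_real_complex _ c).
apply: near_eq_cvg; apply: nearW => F /=.
by rewrite !partial_sumE -sum_real_complex; apply: eq_bigr => i _; rewrite rnorm_sqr.
Qed.

Lemma ell2_dot_ge (F : {fset I}) f :
  (\sum_(i <- F) rnorm (f i) ^+ 2)%:C <= ell2_dot f f.
Proof.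
have [M fM] := ell2P f; rewrite ell2_dotE lecR; apply: ub_le_sup; last by exists F.
by exists M => _ [G _ <-].
Qed.

Lemma ell2_dot_le f (M : R) :
  (forall F : {fset I}, \sum_(i <- F) rnorm (f i) ^+ 2 <= M) ->
  ell2_dot f f <= M%:C.
Proof.
move=> fM; rewrite ell2_dotE lecR; apply: ge_sup => [|_ [F _ <-]//].
by exists (\sum_(i <- fset0) rnorm (f i) ^+ 2), fset0.
Qed.

Lemma ell2_dot_gt0 f : f != 0 -> 0 < ell2_dot f f.
Proof.
move=> f0; have [i fi0] : exists i, f i != 0.
  apply: contrapT => /forallNP f0'; move/eqP: f0; apply.
  by apply/val_inj/funext => i; apply/eqP/negPn/negP; exact: f0'.
apply: lt_le_trans (ell2_dot_ge [fset i]%fset f).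
rewrite big_seq_fset1 ltcR exprn_gt0// lt_def rnorm_ge0 andbT.
by apply: contra_neq fi0 => fi0; apply/eqP; rewrite -normr_eq0 -rnormE fi0.
Qed.

HB.instance Definition _ := bilinear_isBilinear.Build R[i] ell2 ell2 R[i]
  *%R (@Num.conj R[i] \; *%R) ell2_dot (ell2_dot_linearl, ell2_dot_linearr).
HB.instance Definition _ := isHermitianSesquilinear.Build R[i] ell2 false
  (@Num.conj R[i]) ell2_dot ell2_dot_hermitian.
HB.instance Definition _ := isDotProduct.Build R[i] ell2 ell2_dot ell2_dot_gt0.

Let ell2_norm f : R[i] := sqrtC (ell2_dot f f).

Lemma ell2_ler_normD f g : ell2_norm (f + g) <= ell2_norm f + ell2_norm g.
Proof. exact: (@dot_triangle _ _ ell2_dot). Qed.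

Lemma ell2_normZ a f : ell2_norm (a *: f) = `|a| * ell2_norm f.
Proof.
rewrite /ell2_norm (dnormZ ell2_dot) sqrtCM ?nnegrE ?exprn_ge0 ?normr_ge0//.
by rewrite sqrCK ?normr_ge0.
Qed.

Lemma ell2_norm0_eq0 f : ell2_norm f = 0 -> f = 0.
Proof. by move/eqP; rewrite (sqrt_dnorm_eq0 ell2_dot) => /eqP. Qed.

HB.instance Definition _ := Lmodule_isNormed.Build R[i] ell2
  ell2_ler_normD ell2_normZ ell2_norm0_eq0.

Lemma ell2_norm_sqr f : `|f| ^+ 2 = ell2_dot f f.
Proof. exact: sqrtCK. Qed.

Lemma ell2_rnorm_ge (F : {fset I}) f :
  \sum_(i <- F) rnorm (f i) ^+ 2 <= rnorm f ^+ 2.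
Proof.
rewrite -lecR [leRHS]rmorphXn/= rnormE ell2_norm_sqr; exact: ell2_dot_ge.
Qed.

Lemma ell2_rnorm_coord f i : rnorm (f i) <= rnorm f.
Proof.
have := ell2_rnorm_ge [fset i]%fset f; rewrite big_seq_fset1.
by rewrite ler_sqr ?nnegrE ?rnorm_ge0.
Qed.

Lemma ell2_rnorm_le f (e : R) : 0 <= e ->
  (forall F : {fset I}, \sum_(i <- F) rnorm (f i) ^+ 2 <= e ^+ 2) ->
  rnorm f <= e.
Proof.
move=> e0 fe; rewrite -ler_sqr ?nnegrE ?rnorm_ge0//.
by rewrite -lecR [leLHS]rmorphXn/= rnormE ell2_norm_sqr; exact: ell2_dot_le.
Qed.

Lemma cvg_rnorm T (F : set_system T) (FF : Filter F) (V : normedModType R[i])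
    (k : T -> V) (l : V) :
  k @ F --> l -> rnorm (k x) @[x --> F] --> rnorm l.
Proof.
move=> /cvgrPdist_lt kl; apply/cvgrPdist_lt => e e0.
have := kl e%:C; rewrite ltcR => /(_ e0); apply: filterS => x.
by rewrite -rnormE ltcR; apply: le_lt_trans (ler_rnormB _ _).
Qed.

Lemma ell2_complete (F : set_system ell2) :
  ProperFilter F -> cauchy F -> cvg F.
Proof.
move=> FF /cauchy_ballP cF.
have cF' (e : R) : 0 < e ->
    exists2 A, F A & forall f g, A f -> A g -> rnorm (f - g) < e.
  move=> e0; have eC : 0 < e%:C :> R[i] by rewrite ltcR.
  have [[A B]/= [FA FB] AB] := cF _ eC.
  exists (A `&` B); first exact: filterI.
  move=> f g [Af _] [_ Bg]; rewrite -ltcR rnormE.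
  by have := AB (f, g) (conj Af Bg); rewrite -ball_normE.
have /choice[g0 g0P] i : exists l : H, (fun f : ell2 => f i) @ F --> l.
  apply/cvg_ex; apply: cauchy_cvg; apply/cauchy_ballP => e e0.
  have e0' := e0; rewrite -(RRe_real (gtr0_real e0)) ltcR in e0'.
  have [A FA Ae] := cF' _ e0'; pose Ai := (fun f : ell2 => f i) @` A.
  have FAi : F ((fun f : ell2 => f i) @^-1` Ai).
    by apply: filterS FA => f Af; exists f.
  exists (Ai, Ai) => //.
  move=> [_ _] [/= [f Af <-] [g Ag <-]]; rewrite -ball_normE/=.
  rewrite -rnormE -(RRe_real (gtr0_real e0)) ltcR -ell2BE.
  exact: le_lt_trans (ell2_rnorm_coord _ _) (Ae _ _ Af Ag).
have key (e : R) (A : set ell2) : F A -> 0 < e ->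
    (forall f g, A f -> A g -> rnorm (f - g) < e) ->
    forall f, A f -> forall S : {fset I},
      \sum_(i <- S) rnorm (f i - g0 i) ^+ 2 <= e ^+ 2.
  move=> FA e0 Ae f Af S.
  have c : (fun h : ell2 => \sum_(i <- S) rnorm (f i - h i) ^+ 2) @ F -->
           \sum_(i <- S) rnorm (f i - g0 i) ^+ 2.
    elim: (S : seq I) => [|i s IHs].
      by rewrite big_nil; under eq_fun do rewrite big_nil; exact: cvg_cst.
    rewrite big_cons; under eq_fun do rewrite big_cons; apply: cvgD => //.
    have ci : (fun h : ell2 => rnorm (f i - h i)) @ F --> rnorm (f i - g0 i).
      by apply: cvg_rnorm; apply: cvgB; [exact: cvg_cst|exact: g0P].
    by rewrite expr2; under eq_fun do rewrite expr2; exact: cvgM.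
  apply: (cvgr_to_le c); apply: filterS FA => h Ah.
  apply: (le_trans (ell2_rnorm_ge S (f - h))).
  by rewrite ler_sqr ?nnegrE ?rnorm_ge0 ?ltW//; exact: Ae.
have [A FA A1] := cF' 1 ltr01.
have [f1 Af1] := filter_ex FA.
have g_in : g0 \in square_summable.
  have d_in : (f1 : I -> H) - g0 \in square_summable.
    apply/square_summableP; exists (1 ^+ 2) => S.
    exact: key FA ltr01 A1 f1 Af1 S.
  by rewrite -(subKr (f1 : I -> H) g0) rpredB//; exact: ell2_in.
pose g := Ell2 g_in.
apply/cvg_ex; exists g; apply/cvgrPdist_lt => e e0.
have e0' := e0; rewrite -(RRe_real (gtr0_real e0)) ltcR in e0'.
have e2 : 0 < complex.Re e / 2 by rewrite divr_gt0.
have [B FB Be] := cF' _ e2.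
apply: filterS (FB) => f Bf.
rewrite distrC -rnormE -(RRe_real (gtr0_real e0)) ltcR.
rewrite (@le_lt_trans _ _ (complex.Re e / 2))//.
  by apply: ell2_rnorm_le; [exact: ltW|exact: (key _ _ FB e2 Be f Bf)].
by rewrite ltr_pdivrMr// ltr_pMr// ltr1n.
Qed.

HB.instance Definition _ := Uniform_isComplete.Build ell2 ell2_complete.
HB.instance Definition _ := CompleteNormedModule_isHilbert.Build R ell2
  (ell2_norm_sqr : forall x, `|x| ^+ 2 = (ell2_dot : {dot ell2 for @Num.conj R[i]}) x x).

End Ell2.

Section OperatorSpaces.
Context {R : realType} {H : hilbertType R}.
Implicit Types (X : set (bop H)) (S T : bop H).

Definition opnorm T : R := sup [set rnorm (T x) | x in [set x | rnorm x <= 1]].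

Definition opdist T X : R := inf [set opnorm (T - S) | S in X].

(* The set below is empty e.g. for X = B(H); sup set0 = 0, the supremum of the
   empty set in [0, +oo[. *)
Definition annihilator_dist X T : R :=
  sup [set t | exists x y : H, [/\ rnorm x = 1, rnorm y = 1,
    (forall S, X S -> hdot (S x) y = 0) & t = rnorm (hdot (T x) y)]].

Definition operator_space X :=
  X 0 /\ forall (a : R[i]) S T, X S -> X T -> X (a *: S + T).

Definition reflexive_space X := operator_space X /\
  forall T, (forall x, closure [set S x | S in X] (T x)) -> X T.

Definition hyperreflexive X := reflexive_space X /\
  exists2 k : R, 0 < k & forall T, opdist T X <= k * annihilator_dist X T.

Definition adjoint_of S T := forall x y : H, hdot (S x) y = hdot x (T y).

Definition projection T := T \o T = T :> (H -> H) /\ adjoint_of T T.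

Definition commutant X : set (bop H) :=
  [set T : bop H | forall S, X S -> T \o S = S \o T :> (H -> H)].

(* Equality with the bicommutant makes A a unital subalgebra. *)
Definition von_neumann_algebra (A : set (bop H)) :=
  (forall S T, adjoint_of S T -> A S -> A T) /\ commutant (commutant A) = A.

End OperatorSpaces.

Section Amplification.
Context {R : realType} (I : choiceType) {H : hilbertType R}.
Implicit Types x : I -> I -> bop H.

Definition bounded_matrix x := exists M : R,
  forall (F G : {fset I}) (v : I -> H),
    \sum_(i <- F) rnorm (\sum_(j <- G) x i j (v j)) ^+ 2 <=
    M ^+ 2 * \sum_(j <- G) rnorm (v j) ^+ 2.

Definition acts_as_matrix x (T : bop (ell2 I H)) :=
  forall (v : ell2 I H) (i : I),
    partial_sum (fun j => x i j (v j)) @ totally --> (T v : ell2 I H) i.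

Definition amplification (X : set (bop H)) : set (bop (ell2 I H)) :=
  [set T | exists x, [/\ forall i j, X (x i j), bounded_matrix x &
                         acts_as_matrix x T]].

End Amplification.

Arguments amplification {R} I {H} X.

(* Every set is the carrier of a choiceType (gen_choiceMixin). *)
Definition completely_hyperreflexive {R : realType} {H : hilbertType R}
    (X : set (bop H)) :=
  reflexive_space X /\
  forall I : choiceType, hyperreflexive (amplification I X).

(* Main.v *)
Require Import Defs.
From HB Require Import structures.
From mathcomp Require Import all_boot all_order all_algebra.
From mathcomp Require Import finmap complex.
From mathcomp Require Import all_classical all_reals all_analysis.
From mathcomp Require Import summability.

(** The commutants are cut down one projection at a time.  Put
    A_0 = B(H) and let A_(k+1) be the intersection of A_k with the commutant of
    the next projection.  The assumption carries complete hyperreflexivity from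
    A_k to A_(k+1), so what has to be supplied is

    - that every A_k is a von Neumann algebra ([von_neumannI_commutant]): since
      a projection is self-adjoint, taking adjoints preserves its commutant, and
      a commutant equals its own bicommutant;

    - that B(H) itself is completely hyperreflexive
      ([completely_hyperreflexive_setT]).  B(H) is hyperreflexive for any H,
      because T is at distance 0 from it; so it is enough that M_I(B(H)) is all
      of B(ell2 I H), that is, that every bounded operator on ell2 I H acts as
      the bounded matrix of its entries ([amplification_setT]).  Finitely
      supported families are the natural test vectors: on them T is a finite sum
      of entries, and they approximate every family in norm
      ([truncation_cvg]), so continuity of T does the rest;

    - that complete hyperreflexivity implies hyperreflexivity
      ([completely_hyperreflexive_hyperreflexive]).  This is the case of the
      amplification by a one-point set: M_1(X) is the image of X under
      conjugation by the unitary H -> ell2 unit H, and both the distance to a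
      space and the seminorm it is compared with are unitary invariants. *)

Set Implicit Arguments.
Unset Strict Implicit.
Unset Printing Implicit Defensive.

Import Order.TTheory GRing.Theory Num.Theory.
Import numFieldNormedType.Exports.

Local Open Scope classical_set_scope.
Local Open Scope ring_scope.
Local Open Scope complex_scope.

(** * Bounded linear maps *)

Section BoundedLinearMaps.
Context {R : realType}.

(** Convergence in a complex normed space is tested by radii in R[i]; a positive
    element of R[i] is real, so the radii may be taken in R. *)
Lemma cvg_of_rnorm_lt (V : normedModType R[i]) (T : Type) (F : set_system T)
    (FF : Filter F) (f : T -> V) (l : V) :
  (forall e : R, 0 < e -> \forall t \near F, rnorm (l - f t) < e) ->
  f @ F --> l.
Proof.
move=> fl; apply/cvgrPdist_lt => e e0.
have := e0; rewrite -(RRe_real (gtr0_real e0)) ltcR => /fl.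
by apply: filterS => t; rewrite -rnormE ltcR.
Qed.

Lemma rnorm0 (V : normedModType R[i]) : rnorm (0 : V) = 0.
Proof. by rewrite /rnorm normr0. Qed.

Variables H K : hilbertType R.

Lemma bounded_linear_continuous_rnorm (f : H -> K) (M : R) :
  linear f -> (forall x, rnorm (f x) <= M * rnorm x) -> continuous f.
Proof.
move=> lf fM x; apply: cvg_of_rnorm_lt => e e0.
(* The radius e / (|M| + 1) is positive whatever the sign of M. *)
have M1 : 0 < `|M| + 1 by rewrite ltr_wpDl.
have d0 : 0 < e / (`|M| + 1) by rewrite divr_gt0.
have fB y : f x - f y = f (x - y).
  by have := lf (-1) y x; rewrite !scaleN1r addrC => <-; rewrite addrC.
have : \forall y \near x, `|x - y| < (e / (`|M| + 1))%:C.
  by apply: cvgr_dist_lt; [exact: cvg_id|rewrite ltcR].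
apply: filterS => y; rewrite -rnormE ltcR ltr_pdivlMr// mulrC fB.
apply: le_lt_trans; apply: le_trans (fM _) _.
rewrite ler_wpM2r ?rnorm_ge0// (le_trans (ler_norm M))//.
by rewrite lerDl.
Qed.

End BoundedLinearMaps.

Section BoundedOperatorTheory.
Context {R : realType} {H : hilbertType R}.
Implicit Types (S T : bop H).

Lemma bop_linear T : linear T.
Proof. by have /asboolP[] := bop_in T. Qed.

HB.instance Definition _ T :=
  GRing.isLinear.Build R[i] H H *:%R T (bop_linear T).

Lemma bop_continuous T : continuous T.
Proof. by have /asboolP[] := bop_in T. Qed.

Lemma bopBE S T x : (S - T) x = S x - T x. Proof. by []. Qed.

Lemma bop_ext S T : S =1 T -> S = T.
Proof. by move=> ST; apply/val_inj/funext. Qed.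

Lemma bop_bounded T : exists2 M : R, 0 <= M & forall x, rnorm (T x) <= M * rnorm x.
Proof.
have /linear_bounded_continuous/linear_boundedP := @bop_continuous T.
move=> /pinfty_ex_gt0[M M0 TM]; exists (complex.Re M).
  by rewrite -lecR RRe_real ?gtr0_real// ltW.
move=> x; rewrite -lecR rmorphM/= !rnormE RRe_real ?gtr0_real//; exact: TM.
Qed.

End BoundedOperatorTheory.

(** * Distances, and the hyperreflexivity of B(H) *)

Section HyperreflexiveSetT.
Context {R : realType} (H : hilbertType R).
Implicit Types (T : bop H) (X : set (bop H)).

(** An empty or unbounded set has sup equal to 0 by convention. *)
Lemma sup_ge0 (A : set R) : lbound A 0 -> 0 <= sup A.
Proof.
move=> A0; have [supA|/sup_out->//] := pselect (has_sup A).
have [[x Ax] ubA] := supA.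
by apply: (@le_trans _ _ x); [exact: A0|exact: ub_le_sup].
Qed.

Lemma opnorm_ge0 T : 0 <= opnorm T.
Proof. by apply: sup_ge0 => _ [x _ <-]; exact: rnorm_ge0. Qed.

Lemma annihilator_dist_ge0 X T : 0 <= annihilator_dist X T.
Proof. by apply: sup_ge0 => _ [x [y [_ _ _ ->]]]; exact: rnorm_ge0. Qed.

Lemma opnorm0 : opnorm (0 : bop H) = 0.
Proof.
rewrite /opnorm (_ : [set _ | _ in _] = [set 0]) ?sup1//.
apply/seteqP; split=> [_ [x _ <-]|_ ->]/=; first exact: rnorm0.
by exists 0; rewrite /= rnorm0.
Qed.

Lemma opdist_mem X T : X T -> opdist T X = 0.
Proof.
move=> XT; have lb0 : lbound [set opnorm (T - S) | S in X] 0.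
  by move=> _ [S _ <-]; exact: opnorm_ge0.
have im0 : [set opnorm (T - S) | S in X] 0 by exists T; rewrite ?subrr ?opnorm0.
apply/le_anti/andP; split; first by apply: ge_inf im0; exists 0.
by apply: lb_le_inf => //; exists 0.
Qed.

Lemma reflexive_setT : reflexive_space [set: bop H].
Proof. by []. Qed.

Lemma hyperreflexive_setT : hyperreflexive [set: bop H].
Proof.
split; first exact: reflexive_setT.
by exists 1 => // T; rewrite opdist_mem// mul1r annihilator_dist_ge0.
Qed.

End HyperreflexiveSetT.

(** * The matrix of an operator on ell2 I H *)

Section Matrix.
Context {R : realType} (I : choiceType) (H : hilbertType R).
Implicit Types (F G : {fset I}) (v : I -> H) (f g : ell2 I H) (T : bop (ell2 I H)).

Lemma fsum_if (P : pred I) (u : I -> R) F :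
  \sum_(i <- F) (if P i then u i else 0) = \sum_(i <- [fset i in F | P i]%fset) u i.
Proof. by rewrite [RHS]big_fset/= [RHS]big_mkcond. Qed.

Lemma ell2_ext f g : f =1 g -> f = g.
Proof. by move=> fg; apply/val_inj/funext. Qed.

Definition restriction G v : I -> H := fun i => if i \in G then v i else 0.

Lemma restriction_le G v F :
  \sum_(i <- F) rnorm (restriction G v i) ^+ 2 <= \sum_(i <- G) rnorm (v i) ^+ 2.
Proof.
under eq_bigr => i _ do rewrite /restriction (fun_if (fun x => rnorm x ^+ 2))
  rnorm0 expr0n/=.
rewrite fsum_if; apply: le_fsum => [i|]; first exact: sqr_ge0.
by apply/fsubsetP => i; rewrite !inE => /andP[].
Qed.

Lemma restriction_in G v : square_summable (restriction G v).
Proof.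
by apply/square_summableP; eexists => F; exact: restriction_le.
Qed.

Definition truncation G v : ell2 I H := Ell2 (restriction_in G v).

Lemma truncationE G v i : truncation G v i = if i \in G then v i else 0.
Proof. by []. Qed.

Lemma rnorm_truncation G v :
  rnorm (truncation G v) ^+ 2 <= \sum_(i <- G) rnorm (v i) ^+ 2.
Proof.
have s0 : 0 <= \sum_(i <- G) rnorm (v i) ^+ 2 by apply: sumr_ge0 => i _; exact: sqr_ge0.
rewrite -[leRHS]sqr_sqrtr// ler_sqr ?nnegrE ?rnorm_ge0 ?sqrtr_ge0//.
by apply: ell2_rnorm_le => [|F]; rewrite ?sqrtr_ge0// sqr_sqrtr// restriction_le.
Qed.

Definition single j (y : H) : ell2 I H := truncation [fset j]%fset (fun=> y).

Lemma singleE j y i : single j y i = if i == j then y else 0.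
Proof. by rewrite truncationE inE. Qed.

Lemma single_linear j : linear (single j).
Proof.
move=> a x y; apply: ell2_ext => i; rewrite ell2DE ell2ZE !singleE; case: ifP => // _.
by rewrite scaler0 addr0.
Qed.

HB.instance Definition _ j := GRing.isLinear.Build R[i] H (ell2 I H) *:%R
  (single j) (single_linear j).

Lemma rnorm_single j y : rnorm (single j y) <= rnorm y.
Proof.
have := rnorm_truncation [fset j]%fset (fun=> y); rewrite big_seq_fset1.
by rewrite ler_sqr ?nnegrE ?rnorm_ge0.
Qed.

Lemma ell2_sumE (s : seq I) (g : I -> ell2 I H) i :
  (\sum_(j <- s) g j) i = \sum_(j <- s) g j i.
Proof. exact: (big_morph (fun f : ell2 I H => f i)). Qed.

Lemma truncation_sum G v : truncation G v = \sum_(j <- G) single j (v j).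
Proof.
apply: ell2_ext => i; rewrite ell2_sumE truncationE.
under eq_bigr do rewrite singleE.
case: ifPn => iG.
  rewrite (bigD1_seq i)//= eqxx big1 ?addr0// => j; rewrite eq_sym.
  by move=> /negbTE ->.
rewrite big_seq big1// => j jG; case: eqP => // ij.
by rewrite ij jG in iG.
Qed.

(** The squared norm of the tail f - truncation G f is at most the difference
    between the squared norm of f and its partial sum over G, because a partial
    sum of the tail over F and the partial sum of f over G add up to the partial
    sum of f over the union of F and G. *)
Lemma truncation_cvg f : truncation G f @[G --> totally] --> f.
Proof.
apply: cvg_of_rnorm_lt => e e0.
have sumf : partial_sum (fun i => rnorm (f i) ^+ 2) @ totally --> rnorm f ^+ 2.
  have := nneg_sum_cvg (fun i => sqr_ge0 (rnorm (f i))) (fun F => ell2_rnorm_ge F f).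
  have <-// : rnorm f ^+ 2 =
      sup [set \sum_(i <- F) rnorm (f i) ^+ 2 | F in [set: {fset I}]].
  by apply: complexI; rewrite rnorm_sqr; exact: ell2_dotE.
have e20 : 0 < (e / 2) ^+ 2 by rewrite exprn_gt0 ?divr_gt0.
have /cvgrPdist_lt/(_ _ e20) := sumf.
apply: filterS => G; rewrite partial_sumE => /ltW/ler_normlW Ge.
(* The norm is a supremum of partial sums, so bounding these gives only a weak
   inequality; the radius e / 2 makes it strict. *)
rewrite (@le_lt_trans _ _ (e / 2)) ?gtr_pMr ?invf_lt1 ?ltr1n//.
apply: ell2_rnorm_le => [|F]; first by rewrite ltW// divr_gt0.
apply: le_trans Ge; rewrite lerBrDl.
apply: le_trans (ell2_rnorm_ge (G `|` F)%fset f).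
rewrite (big_fsetID _ (fun i => i \in G) (G `|` F)%fset)/=.
have -> : [fset x in (G `|` F)%fset | x \in G]%fset = G.
  by apply/fsetP => i; rewrite !inE/=; case: (i \in G); rewrite ?andbF.
rewrite lerD2l.
rewrite [leLHS](eq_bigr (fun i => if i \notin G then rnorm (f i) ^+ 2 else 0)); last first.
  move=> i _; rewrite -[(_ - _) i]/(f i - truncation G f i) truncationE.
  by case: ifP => _ /=; rewrite ?subr0// subrr rnorm0 expr0n.
rewrite fsum_if; apply: le_fsum => [i|]; first exact: sqr_ge0.
apply/fsubsetP => i; rewrite !inE/= => /andP[-> ->].
by rewrite orbT.
Qed.

Lemma entry_in T i j : bounded_operator (fun y => T (single j y) i).
Proof.
have lin : linear (fun y => T (single j y) i).
  by move=> a x y; rewrite single_linear linearP.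
have [M M0 TM] := bop_bounded T.
apply/asboolP; split=> //; apply: (bounded_linear_continuous_rnorm (M := M)) => // y.
apply: le_trans (ell2_rnorm_coord _ _) _; apply: le_trans (TM _) _.
by rewrite ler_wpM2l// rnorm_single.
Qed.

Definition entry T i j : bop H := Bop (entry_in T i j).

(** The link between finite matrix sums and the operator: all estimates on the
    matrix of T are estimates of T at finitely supported families. *)
Lemma entry_sum T G v i : \sum_(j <- G) entry T i j (v j) = T (truncation G v) i.
Proof. by rewrite truncation_sum linear_sum ell2_sumE. Qed.

Lemma entry_bounded_matrix T : bounded_matrix (entry T).
Proof.
have [M M0 TM] := bop_bounded T; exists M => F G v.
under eq_bigr do rewrite entry_sum.
apply: le_trans (ell2_rnorm_ge _ _) _.
apply: (@le_trans _ _ (M ^+ 2 * rnorm (truncation G v) ^+ 2)).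
  by rewrite -exprMn ler_sqr ?nnegrE ?mulr_ge0 ?rnorm_ge0.
by rewrite ler_wpM2l ?sqr_ge0// rnorm_truncation.
Qed.

Lemma entry_acts_as_matrix T : acts_as_matrix (entry T) T.
Proof.
move=> f i; apply: cvg_of_rnorm_lt => e e0.
have Tf : T (truncation G f) @[G --> totally] --> T f.
  by apply: (cvg_comp _ _ (truncation_cvg (f := f))); exact: bop_continuous.
have eC : 0 < e%:C :> R[i] by rewrite ltcR.
have /cvgrPdist_lt/(_ _ eC) := Tf; apply: filterS => G.
rewrite -rnormE ltcR partial_sumE entry_sum -ell2BE.
exact: le_lt_trans (ell2_rnorm_coord _ _).
Qed.

(** Membership in M_I(X) asks for a matrix that is bounded and represents T; the
    entries of T always form one. *)
Lemma amplification_of_entries (X : set (bop H)) T :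
  (forall i j, X (entry T i j)) -> amplification I X T.
Proof.
move=> XT; exists (entry T); split=> //.
  exact: entry_bounded_matrix.
exact: entry_acts_as_matrix.
Qed.

Lemma amplification_setT : amplification I [set: bop H] = [set: bop (ell2 I H)].
Proof. by apply/seteqP; split=> // T _; exact: amplification_of_entries. Qed.

End Matrix.

Lemma completely_hyperreflexive_setT (R : realType) (H : hilbertType R) :
  completely_hyperreflexive [set: bop H].
Proof.
split=> [|I]; first exact: reflexive_setT.
by rewrite amplification_setT; exact: hyperreflexive_setT.
Qed.

(** * Unitary invariance of hyperreflexivity *)

Section UnitaryEquivalence.
Context {R : realType} (H K : hilbertType R) (U : {linear H -> K}) (V : K -> H).
Hypotheses (UK : cancel U V) (VK : cancel V U).
Hypothesis U_dot : forall x y, hdot (U x) (U y) = hdot x y.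
Implicit Types (S T : bop H) (X : set (bop H)).

Lemma unitary_rnorm x : rnorm (U x) = rnorm x.
Proof.
apply/eqP; rewrite -(@eqrXn2 _ 2) ?rnorm_ge0//; apply/eqP/complexI.
by rewrite !rnorm_sqr U_dot.
Qed.

Lemma conjugate_in T : bounded_operator (U \o T \o V).
Proof.
have lin : linear (U \o T \o V).
  move=> a x y /=; suff -> : V (a *: x + y) = a *: V x + V y by rewrite !linearP.
  by apply: (can_inj UK); rewrite linearP !VK.
have [M M0 TM] := bop_bounded T.
apply/asboolP; split=> //; apply: (bounded_linear_continuous_rnorm (M := M)) => // y.
by rewrite -{2}(VK y) /= !unitary_rnorm.
Qed.

Definition conjugate T : bop K := Bop (conjugate_in T).

Lemma conjugateE T x : conjugate T (U x) = U (T x).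
Proof. by rewrite /= UK. Qed.

Lemma conjugateB S T : conjugate (S - T) = conjugate S - conjugate T.
Proof. by apply: bop_ext => y; rewrite -(VK y) bopBE !conjugateE bopBE linearB. Qed.

Lemma opnorm_conjugate T : opnorm (conjugate T) = opnorm T.
Proof.
congr sup; apply/seteqP; split=> _ [x x1 <-].
  exists (V x); first by rewrite /= -unitary_rnorm VK.
  by rewrite -[LHS]unitary_rnorm.
by exists (U x); [rewrite /= unitary_rnorm|rewrite conjugateE unitary_rnorm].
Qed.

(** Here and in [annihilator_dist_conjugate], U puts the competing vectors and
    operators on both sides in bijection, so the two sets of values are equal. *)
Lemma opdist_conjugate T X : opdist (conjugate T) (conjugate @` X) = opdist T X.
Proof.
congr inf; rewrite image_comp; apply: eq_imagel => S _ /=.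
by rewrite -conjugateB opnorm_conjugate.
Qed.

Lemma annihilator_dist_conjugate T X :
  annihilator_dist (conjugate @` X) (conjugate T) = annihilator_dist X T.
Proof.
congr sup; apply/seteqP; split=> t [x [y [x1 y1 Xxy ->]]].
  exists (V x), (V y); rewrite -!unitary_rnorm !VK; split=> //.
    by move=> S XS; rewrite -U_dot -conjugateE !VK; apply: Xxy; exists S.
  by rewrite -U_dot -conjugateE !VK.
exists (U x), (U y); rewrite !unitary_rnorm; split=> //.
  by move=> _ [S XS <-]; rewrite conjugateE U_dot Xxy.
by rewrite conjugateE U_dot.
Qed.

Lemma hyperreflexive_conjugate X :
  reflexive_space X -> hyperreflexive (conjugate @` X) -> hyperreflexive X.
Proof.
move=> rX [_ [k k0 kX]]; split=> //; exists k => // T.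
by rewrite -opdist_conjugate -annihilator_dist_conjugate; exact: kX.
Qed.

End UnitaryEquivalence.

(** * Amplification by a one-point set *)

Section OneByOne.
Context {R : realType} (H : hilbertType R).
Implicit Types (S T : bop H) (X : set (bop H)).

(** From the index set {tt} on, every partial sum is the single term. *)
Lemma partial_sum_unit_cvg (V : normedModType R[i]) (g : unit -> V) :
  partial_sum g @ totally --> g tt.
Proof.
apply: cvg_near_cst; exists [fset tt]%fset => // F /= F1.
have -> : F = [fset tt]%fset by apply/eqP; rewrite eqEfsubset F1 andbT;
  apply/fsubsetP => -[]; rewrite inE.
by rewrite partial_sumE big_seq_fset1.
Qed.

Lemma single_tt : cancel (@single R unit H tt) (fun f : ell2 unit H => f tt).
Proof. by move=> x; rewrite singleE. Qed.

Lemma tt_single : cancel (fun f : ell2 unit H => f tt) (@single R unit H tt).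
Proof. by move=> f; apply: ell2_ext => -[]; rewrite single_tt. Qed.

Lemma hdot_single (x y : H) : hdot (single tt x) (single tt y) = hdot x y.
Proof.
rewrite -[LHS]/(ell2_dot (single tt x) (single tt y)).
have c := @ell2_dot_cvg R unit H (single tt x) (single tt y).
have c' := @partial_sum_unit_cvg R[i]^o
  (fun i => hdot (single tt x i) (single tt y i)).
by rewrite (cvg_unique _ c c') ?single_tt//; exact: norm_hausdorff.
Qed.

Definition ampliation1 : bop H -> bop (ell2 unit H) :=
  conjugate single_tt tt_single hdot_single.

Lemma amplification_unit X : amplification unit X = ampliation1 @` X.
Proof.
apply/seteqP; split=> [T [x [xX _ xT]]|_ [S XS <-]].
  exists (x tt tt) => //; apply: bop_ext => f; apply: ell2_ext => -[].
  rewrite -[LHS]/(single tt (x tt tt (f tt)) tt) single_tt.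
  apply: (cvg_unique _ _ (xT f tt)); first exact: norm_hausdorff.
  exact: (@partial_sum_unit_cvg H (fun j => x tt j (f j))).
apply: amplification_of_entries => -[] [].
suff -> : entry (ampliation1 S) tt tt = S by [].
apply: bop_ext => y; rewrite -[LHS]/(ampliation1 S (single tt y) tt).
by rewrite [ampliation1 S _]conjugateE single_tt.
Qed.

End OneByOne.

Lemma completely_hyperreflexive_hyperreflexive (R : realType)
    (H : hilbertType R) (X : set (bop H)) :
  completely_hyperreflexive X -> hyperreflexive X.
Proof.
move=> [rX /(_ unit)]; rewrite amplification_unit.
exact: hyperreflexive_conjugate.
Qed.

(** * Von Neumann algebras *)

Section VonNeumann.
Context {R : realType} {H : hilbertType R}.
Implicit Types (S T Q : bop H) (A B : set (bop H)).

Lemma commutantS A B : A `<=` B -> commutant B `<=` commutant A.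
Proof. by move=> AB T BT S /AB; exact: BT. Qed.

Lemma sub_bicommutant A : A `<=` commutant (commutant A).
Proof. by move=> T AT S AS; rewrite AS. Qed.

Lemma hdot_injr (y z : H) : (forall x, hdot x y = hdot x z) -> y = z.
Proof.
move=> yz; apply/eqP; rewrite -subr_eq0 -(dnorm_eq0 hdot).
by rewrite linearBr/= yz subrr.
Qed.

(** Taking adjoints in S Q = Q S: for all x and y,
    <x, T Q y> = <Q S x, y> = <S Q x, y> = <x, Q T y>. *)
Lemma adjoint_commute S T Q : adjoint_of S T -> adjoint_of Q Q ->
  S \o Q = Q \o S :> (H -> H) -> T \o Q = Q \o T :> (H -> H).
Proof.
move=> ST QQ SQ; apply/funext => y /=; apply: hdot_injr => x.
by rewrite -ST -QQ -[Q (S x)]/((Q \o S) x) -SQ /= ST QQ.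
Qed.

Lemma von_neumann_setT : von_neumann_algebra [set: bop H].
Proof. by split=> //; apply/seteqP; split=> //; exact: sub_bicommutant. Qed.

(** The bicommutant is monotone, so that of the intersection lies in A'' = A and
    in the triple commutant of Q, which is the commutant of Q. *)
Lemma von_neumannI_commutant A Q : von_neumann_algebra A -> adjoint_of Q Q ->
  von_neumann_algebra (A `&` commutant [set Q]).
Proof.
move=> [A_adj A_bicomm] QQ; split=> [S T ST [AS SQ]|].
  split; first exact: A_adj ST AS.
  by move=> _ ->; apply: adjoint_commute ST QQ _; exact: SQ.
apply/seteqP; split; last exact: sub_bicommutant.
rewrite subsetI -{2}A_bicomm; split; first by do 2!apply: commutantS.
apply: subset_trans (commutantS (@sub_bicommutant [set Q])).
by do 2!apply: commutantS.
Qed.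

End VonNeumann.

Theorem theorem3p1 (R : realType) :
  (forall (H : hilbertType R) (A : set (bop H)) (Q : bop H),
      von_neumann_algebra A -> completely_hyperreflexive A -> projection Q ->
      completely_hyperreflexive (A `&` commutant [set Q])) ->
  forall (H : hilbertType R) (n : nat) (Q : 'I_n -> bop H),
    (forall i, projection (Q i)) ->
    hyperreflexive (\bigcap_i commutant [set Q i]).
Proof.
move=> stable H n Q projQ; apply: completely_hyperreflexive_hyperreflexive.
(* Both properties go through the induction together: the assumption applies
   to a space only when it is known to be a von Neumann algebra. *)
suff [] : von_neumann_algebra (\bigcap_i commutant [set Q i]) /\
  completely_hyperreflexive (\bigcap_i commutant [set Q i]) by [].
elim: n => [|n IH] in Q projQ *.
  have -> : \bigcap_i commutant [set Q i] = [set: bop H].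
    by apply/seteqP; split=> // T _ [].
  by split; [exact: von_neumann_setT|exact: completely_hyperreflexive_setT].
have [vN CH] := IH (fun i => Q (lift ord0 i)) (fun i => projQ _).
have -> : \bigcap_i commutant [set Q i] =
    \bigcap_i commutant [set Q (lift ord0 i)] `&` commutant [set Q ord0].
  apply/seteqP; split=> [T QT|T [QT Q0T] i _]; first by split=> [i _|]; exact: QT.
  by case: (unliftP ord0 i) => [j|] ->; [exact: QT|].
split; last exact: stable.
by apply: von_neumannI_commutant => //; case: (projQ ord0).
Qed.
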